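(* Let $\mathcal{L}$ be a complete modular lattice and let $\mathfrak{m}$ be a submonoid with zero of $\mathrm{End}_{lin}(\mathcal{L})$ containing all the projections. The following conditions are equivalent: (a) $\mathcal{L}$ is $\mathfrak{m}$-Rickart. (b) $\mathcal{L}$ is $\mathfrak{m}$-$\mathcal{K}$-extending and $\mathfrak{m}$-$\mathcal{K}$-nonsingular.
   Context: $\mathbf{0},\mathbf{1}$ denote the least and greatest elements; $[a,b]=\{x: a\le x\le b\}$. An element $x$ has a complement if there is $x'$ with $x\wedge x'=\mathbf{0}$, $x\vee x'=\mathbf{1}$; $C(\mathcal{L})$ is the set of elements of $\mathcal{L}$ having a complement. An element $x$ of a bounded lattice is essential if $x\wedge y=\mathbf{0}$ implies $y=\mathbf{0}$. Linear morphism: a map $\varphi:\mathcal{L}\to\mathcal{L}'$ between bounded lattices is linear if there exist $\ker_\varphi\in\mathcal{L}$ (the kernel) and $a'\in\mathcal{L}'$ such that (1) $\varphi(x)=\varphi(x\vee\ker_\varphi)$ for all $x$; (2) $\varphi$ restricts to a lattice isomorphism $[\ker_\varphi,\mathbf{1}]\to[\mathbf{0},a']$ (so $a'=\varphi(\mathbf{1})$). $\mathrm{End}_{lin}(\mathcal{L})$ is the monoid of linear morphisms $\mathcal{L}\to\mathcal{L}$ under composition; its zero $0$ is the constant map $\mathbf{0}$. A submonoid with zero contains the identity and the zero morphism. For $x$ with complement $x'$, the projection $\pi_x:\mathcal{L}\to\mathcal{L}$ (with respect to $x'$) is $\pi_x(a)=(a\vee x')\wedge x$. $\mathfrak{m}$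 contains all the projections if $\pi_x\in\mathfrak{m}$ for every $x\in C(\mathcal{L})$ (and every choice of complement $x'$). $\mathcal{L}$ is $\mathfrak{m}$-Rickart if $\ker_\varphi$ has a complement for all $\varphi\in\mathfrak{m}$. $\mathcal{L}$ is $\mathfrak{m}$-$\mathcal{K}$-extending if for every $\varphi\in\mathfrak{m}$ there is $c\in C(\mathcal{L})$ such that $\ker_\varphi$ is essential in $[\mathbf{0},c]$ (in particular $\ker_\varphi\le c$). $\mathcal{L}$ is $\mathfrak{m}$-$\mathcal{K}$-nonsingular if for every $\varphi\in\mathfrak{m}$, $\ker_\varphi$ essential in $\mathcal{L}$ implies $\varphi=0$. *)

(* Defs.v *)
From mathcomp Require Import all_boot all_order.
From mathcomp Require Import interval.
From mathcomp Require Import boolp classical_sets functions set_interval.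

Set Implicit Arguments.
Unset Strict Implicit.
Unset Printing Implicit Defensive.

Import Order.Theory.

Local Open Scope classical_set_scope.
Local Open Scope order_scope.

Section Lattice.
Context {d : Order.disp_t} (L : tbLatticeType d).
Implicit Types x y a b c : L.

Definition modular_lattice : Prop :=
  forall x y z : L, x <= z -> x `|` (y `&` z) = (x `|` y) `&` z.

(* Existence of all suprema, including that of set0, gives all infima. *)
Definition complete_lattice : Prop :=
  forall A : set L, supremums A !=set0.

Definition is_complement x x' : Prop := x `&` x' = \bot /\ x `|` x' = \top.

Definition complemented : set L := [set x | exists x', is_complement x x'].

(* x is an essential element of the bounded lattice [a, b], whose least
   element is a. *)
Definition essential_in a b x : Prop :=
  `[a, b]%classic x /\ forall y, `[a, b]%classic y -> x `&` y = a -> y = a.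

Definition essential x : Prop := forall y, x `&` y = \bot -> y = \bot.

(* The projection on x with respect to its complement x'. *)
Definition proj x x' : L -> L := fun a => (a `|` x') `&` x.

End Lattice.

Section Linear.
Context {d d' : Order.disp_t} {L : tbLatticeType d} {L' : tbLatticeType d'}.
Implicit Types f : L -> L'.

(* A and B are meant to be sublattices, here always intervals. *)
Definition lattice_iso_on (A : set L) (B : set L') f : Prop :=
  [/\ set_bij A B f,
      forall x y, A x -> A y -> f (x `&` y) = f x `&` f y &
      forall x y, A x -> A y -> f (x `|` y) = f x `|` f y].

Definition is_kernel f (k : L) : Prop :=
  (forall x, f x = f (x `|` k)) /\
  exists a' : L', lattice_iso_on `[k, \top]%classic `[\bot, a']%classic f.

Definition linear f : Prop := exists k, is_kernel f k.

Lemma is_kernel_uniq f k1 k2 : is_kernel f k1 -> is_kernel f k2 -> k1 = k2.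
Proof.
suff ker_le k k' : is_kernel f k -> is_kernel f k' -> k <= k'.
  by move=> h1 h2; apply/le_anti/andP; split; apply: ker_le.
have fk0 l : is_kernel f l -> f l = \bot.
  case=> _ [a' [[fun_f inj_f surj_f] fI _]].
  have [|l0 /=] := surj_f \bot; first by rewrite /= in_itv /= lexx le0x.
  rewrite in_itv /= => /andP[le_l _] fl0.
  have := fI l l0; rewrite /= !in_itv /= lexx le_l !lex1 => /(_ isT isT).
  by rewrite (meet_l le_l) fl0 meetx0.
move=> hk hk'; have [fk' [a' [[_ inj_f _] _ _]]] := hk'.
suff <- : k `|` k' = k' by exact: leUl.
apply: inj_f; rewrite ?inE /= ?in_itv /= ?lexx ?lex1 ?leUr //.
by rewrite -fk' !fk0.
Qed.

(* Junk value \bot when f is not linear. *)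
Definition ker f : L := xget \bot [set k | is_kernel f k].

Lemma kerP f : linear f -> is_kernel f (ker f).
Proof. exact: xgetPex. Qed.

End Linear.

Section Endomorphisms.
Context {d : Order.disp_t} {L : tbLatticeType d}.
Implicit Types m : set (L -> L).

Definition zero_map : L -> L := fun=> \bot.

Definition submonoid_with_zero m : Prop :=
  [/\ forall f, m f -> linear f,
      m id,
      m zero_map &
      forall f g, m f -> m g -> m (f \o g)].

Definition contains_projections m : Prop :=
  forall x x' : L, is_complement x x' -> m (proj x x').

Definition Rickart m : Prop := forall f, m f -> complemented (ker f).

Definition K_extending m : Prop :=
  forall f, m f -> exists2 c, complemented c & essential_in \bot c (ker f).

Definition K_nonsingular m : Prop :=
  forall f, m f -> essential (ker f) -> f = zero_map.

End Endomorphisms.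

(* Main.v *)
Require Import Defs.
From mathcomp Require Import all_boot all_order.
From mathcomp Require Import interval.
From mathcomp Require Import boolp classical_sets functions set_interval.

(** If every kernel is complemented, then a kernel is trivially essential below
    itself, and an essential kernel has complement [\bot], hence is [\top]; this
    is the easy direction.

    Conversely let [k] be the kernel of [f] and let [k] be essential in
    [[\bot, c]], where [c] has complement [c'].  The idea is to precompose [f]
    with the projection on [c] along [c'], so as to discard the part of the
    lattice where [k] is not essential.  A linear map kills exactly what lies
    below its kernel, so the kernel of [f \o proj c c'] is [k `|` c']
    ([ker_comp_proj]).  By modularity [k `|` c'] is essential in the whole
    lattice ([essential_joinC]), so nonsingularity makes [f \o proj c c'] zero.
    Evaluating at [\top] gives [f c = \bot], that is [c <= k]: the kernel [k]
    is the complemented element [c]. *)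

Set Implicit Arguments.
Unset Strict Implicit.
Unset Printing Implicit Defensive.

Import Order.Theory.

Local Open Scope classical_set_scope.
Local Open Scope order_scope.

Section Kernel.
Context {d d' : Order.disp_t} {L : tbLatticeType d} {L' : tbLatticeType d'}.
Implicit Types f : L -> L'.

Lemma linear_ker0 f : linear f -> f (ker f) = \bot.
Proof.
move=> /kerP; set k := ker f; case=> _ [a' [[_ _ surj_f] fI _]].
(* The lattice isomorphism [[k, \top] -> [\bot, a']] is monotone, so the
   preimage of [\bot], being above [k], forces [f k = \bot]. *)
have [|x /=] := surj_f \bot; first by rewrite /= in_itv /= lexx le0x.
rewrite in_itv /= => /andP[le_kx _] fx0.
have := fI k x; rewrite /= !in_itv /= lexx le_kx !lex1 => /(_ isT isT).
by rewrite (meet_l le_kx) fx0 meetx0.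
Qed.

(** The order-theoretic meaning of the kernel: it is the largest element sent to
    [\bot], which determines it without reference to the isomorphism. *)
Lemma linear_eq0 f x : linear f -> f x = \bot <-> x <= ker f.
Proof.
move=> lin_f; have fk0 := linear_ker0 lin_f.
have [fk [a' [[_ inj_f _] _ _]]] := kerP lin_f.
split=> [fx0|/join_r le_xk]; last by rewrite fk le_xk.
suff <- : x `|` ker f = ker f by exact: leUl.
apply: inj_f; rewrite ?inE /= ?in_itv /= ?lexx ?lex1 ?leUr //.
by rewrite -fk fk0.
Qed.

End Kernel.

Section Modular.
Context {d : Order.disp_t} (L : tbLatticeType d) (modL : modular_lattice L).
Implicit Types (k c y : L) (f : L -> L).

Lemma proj_le k c c' y : is_complement c c' -> k <= c ->
  (proj c c' y <= k) = (y <= k `|` c').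
Proof.
move=> [cI cU] le_kc; apply/idP/idP => [le_pk|le_y].
  (* By modularity [y `|` c'] is recovered as [c' `|` proj c c' y]. *)
  have defU : c' `|` (c `&` (y `|` c')) = y `|` c'.
    by rewrite modL ?leUr // (joinC c') cU meet1x.
  apply: (@le_trans _ _ (y `|` c')); first exact: leUl.
  by rewrite -defU leUx leUr /= meetC (le_trans le_pk) ?leUl.
have <- : (k `|` c') `&` c = k by rewrite -modL // meetC cI joinx0.
by rewrite leI2 // leUx le_y leUr.
Qed.

(** What [k `|` c'] misses is carried by [proj c c'] to something below [c] that
    [k] misses. *)
Lemma essential_joinC k c c' : is_complement c c' ->
  essential_in \bot c k -> essential (k `|` c').
Proof.
move=> cc' [/=]; rewrite in_itv /= => /andP[_ le_kc] ess_k y ky0.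
suff le_yk : y <= k `|` c' by rewrite -ky0 (meet_r le_yk).
rewrite -(proj_le y cc' le_kc).
suff -> : proj c c' y = \bot by exact: le0x.
apply: ess_k; first by rewrite /= in_itv /= le0x leIr.
(* The meet lies below both [c] and [(y `|` c') `&` (k `|` c')], and the latter
   is [c'] by modularity. *)
have defc' : (c' `|` y) `&` (k `|` c') = c'.
  by rewrite -modL ?leUr // meetC ky0 joinx0.
apply/eqP; rewrite -lex0 -cc'.1 lexI (le_trans (leIl _ _)) //=.
rewrite -[X in _ <= X]defc' lexI; apply/andP; split.
  by rewrite joinC (le_trans (leIr _ _)) // /proj leIl.
by rewrite (le_trans (leIl _ _)) // leUl.
Qed.

Lemma ker_comp_proj f c c' : linear f -> linear (f \o proj c c') ->
  is_complement c c' -> ker f <= c -> ker (f \o proj c c') = ker f `|` c'.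
Proof.
move=> lin_f lin_fp cc' le_kc.
have le_ker y : (y <= ker (f \o proj c c')) = (y <= ker f `|` c').
  rewrite -(proj_le y cc' le_kc).
  by apply/idP/idP => [/(linear_eq0 _ lin_fp)|le_p];
    [move/(linear_eq0 _ lin_f) | apply/(linear_eq0 _ lin_fp)/(linear_eq0 _ lin_f)].
by apply/le_anti; rewrite -le_ker lexx le_ker lexx.
Qed.

End Modular.

Theorem proposition4p2 (d : Order.disp_t) (L : tbLatticeType d)
    (m : set (L -> L)) :
  complete_lattice L -> modular_lattice L ->
  submonoid_with_zero m -> contains_projections m ->
  Rickart m <-> (K_extending m /\ K_nonsingular m).
Proof.
move=> _ modL [m_lin _ _ m_comp] m_proj; split.
  move=> rickart; split=> f mf.
    exists (ker f); first exact: rickart.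
    split=> [|y]; first by rewrite /= in_itv /= le0x lexx.
    by rewrite /= in_itv /= => /andP[_ /meet_r ->].
  have [k' [kI kU]] := rickart _ mf.
  move=> /(_ _ kI) k'0; rewrite k'0 joinx0 in kU.
  by apply/funext => x; apply/(linear_eq0 _ (m_lin _ mf)); rewrite kU lex1.
move=> [ext nonsing] f mf.
have [c [c' cc'] ess_k] := ext _ mf.
have le_kc : ker f <= c by have := ess_k.1; rewrite /= in_itv => /andP[].
have m_fp : m (f \o proj c c') by apply: m_comp => //; exact: m_proj.
have fp0 : f \o proj c c' = @zero_map _ L.
  apply: nonsing => //.
  rewrite (ker_comp_proj modL (m_lin _ mf) (m_lin _ m_fp) cc' le_kc).
  exact: (essential_joinC modL cc' ess_k).
have fc0 : f c = \bot.
  by have := congr1 (@^~ \top) fp0; rewrite /= /proj join1x meet1x.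
suff -> : ker f = c by exists c'.
by apply/le_anti; rewrite le_kc; apply/(linear_eq0 _ (m_lin _ mf)).
Qed.
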